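(* Let $f$ be any power series in $N$ complex variables (centered at the origin) whose domain of convergence $D$ is neither empty nor the whole space $\mathbb{C}^N$. Then $\tau(S_f)=\tau(\partial D)$, where $S_f\subset\partial D$ is the set of all singular points of $f$ and $\tau:\mathbb{C}^N\to\mathbb{R}_+^N$ is the absolute map $\tau(z)=(|z_1|,\dots,|z_N|)$.
   Context: The domain of convergence of a power series $\sum_{J\in\mathbb{N}_0^N} c_Jz^J$ (with $\mathbb{N}_0=\mathbb{N}\cup\{0\}$) is the interior of the set of points of $\mathbb{C}^N$ at which the series converges absolutely. $\mathbb{R}_+$ is the set of non-negative reals. A point $p\in\partial D$ is a regular point for $f$ if there exist an open polydisc $U$ centered at $p$ and a holomorphic function $g$ on $U$ such that $g|_{U\cap D}=f|_{U\cap D}$; a point of $\partial D$ which is not regular for $f$ is called a (completely) singular point of $f$. *)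

(* Defs.v *)
From HB Require Import structures.
From mathcomp Require Import all_boot all_order all_algebra.
From mathcomp Require Import complex.
From mathcomp Require Import all_classical all_reals all_analysis.
(* Not imported: its [summable] would shadow the one of [esum]. *)
From mathcomp Require summability.

Set Implicit Arguments.
Unset Strict Implicit.
Unset Printing Implicit Defensive.

Import Order.TTheory GRing.Theory Num.Theory.
Import numFieldNormedType.Exports.
Import Normc.

Local Open Scope classical_set_scope.
Local Open Scope ring_scope.

(* Typing R[i] as a [numClosedFieldType] is what gives it, and the matrices over
   it, the topology and the normed module structure induced by its norm. *)
Definition C (R : realType) : numClosedFieldType := R[i].

(* The norm `|z| of C R has values in C R; the R-valued modulus is [normc]. *)
Definition absolute_map (R : realType) (N : nat) (z : 'rV[C R]_N) : 'rV[R]_N :=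
  \row_i normc (z ord0 i).

Definition boundary (T : topologicalType) (A : set T) : set T :=
  closure A `\` interior A.

Section power_series.
Variables (R : realType) (N : nat).
Implicit Types (c : {ffun 'I_N -> nat} -> C R) (z p : 'rV[C R]_N).

Definition power_term c z (J : {ffun 'I_N -> nat}) : C R :=
  c J * \prod_(i < N) z ord0 i ^+ J i.

Definition converges_absolutely c z : Prop :=
  summable [set: {ffun 'I_N -> nat}] (fun J => (normc (power_term c z J))%:E).

Definition domain_of_convergence c : set 'rV[C R]_N :=
  interior [set z | converges_absolutely c z].

(* Limit of the finite partial sums along the directed set of finite sets of
   multi-indices; only meaningful where this net converges, in particular on
   [domain_of_convergence c]. *)
Definition power_series_sum c z : C R := summability.sum (power_term c z).

Definition polydisc p (r : 'I_N -> R) : set 'rV[C R]_N :=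
  [set z | forall i, normc (z ord0 i - p ord0 i) < r i].

(* [differentiable] is Frechet differentiability over the scalar field C R,
   that is, complex differentiability in all the variables jointly. *)
Definition holomorphic_on (U : set 'rV[C R]_N) (g : 'rV[C R]_N -> C R) : Prop :=
  forall z, U z -> differentiable g z.

Definition regular_point (D : set 'rV[C R]_N) (f : 'rV[C R]_N -> C R) p : Prop :=
  boundary D p /\
  exists2 r : 'I_N -> R, (forall i, 0 < r i) &
  exists2 g : 'rV[C R]_N -> C R, holomorphic_on (polydisc p r) g &
    forall z, polydisc p r z -> D z -> g z = f z.

Definition singular_points (D : set 'rV[C R]_N) (f : 'rV[C R]_N -> C R) :
    set 'rV[C R]_N :=
  [set p | boundary D p /\ ~ regular_point D f p].

End power_series.

(* Main.v *)
(** Suppose that every point of the torus through a boundary point [p] is regular.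
    By compactness the extensions exist on polydiscs of one radius [delta] around
    all the points of the torus, with one bound [M]. Put [kappa = delta / 4] and
    take [s] slightly below [tau p]. For [w] in the unit torus, the extension along
    [l |-> w * (s + l * kappa)] is holomorphic and bounded by [M] for [|l| < 2],
    and agrees with the series near [0]. The Cauchy estimate bounds its [m]-th
    coefficient, and averaging over [w] isolates a single multi-index:
    [|c_J| * [l^m] (s + l * kappa)^J <= M]. Summing over [m] at [l = 1/2] yields
    [|c_J| * (s + kappa / 2)^J <= 2 * M], so the series converges in a polydisc
    containing a neighbourhood of [p]. *)

Require Import Defs.
From mathcomp Require Import all_boot all_order all_algebra.
From mathcomp Require Import finmap complex.
From mathcomp Require Import all_classical all_reals all_analysis.
From mathcomp Require summability.
From mathcomp Require Import ring lra zify.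
Import Order.TTheory GRing.Theory Num.Theory.
Import numFieldNormedType.Exports.
Import Normc.

Set Implicit Arguments.
Unset Strict Implicit.
Unset Printing Implicit Defensive.

Local Open Scope classical_set_scope.
Local Open Scope ring_scope.

Section modulus.
Variable R : realType.
Implicit Types (x y : R) (z w : C R).

Lemma normc_ge0 z : 0 <= normc z.
Proof. by case: z => a b; rewrite /normc sqrtr_ge0. Qed.

Lemma normC_normc z : `|z| = (normc z)%:C%C :> C R.
Proof. by rewrite [LHS]normc_def; case: z. Qed.

Lemma normc_real x : normc x%:C%C = `|x|.
Proof. by rewrite /normc /= expr0n /= addr0 sqrtr_sqr. Qed.

Lemma normc_zero : normc (0 : C R) = 0.
Proof. exact: normc0. Qed.

Lemma normc_one : normc (1 : C R) = 1.
Proof. exact: normc1. Qed.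

Lemma normc_mul z w : normc (z * w) = normc z * normc w.
Proof. exact: normcM. Qed.

Lemma normc_add z w : normc (z + w) <= normc z + normc w.
Proof. exact: le_normcD. Qed.

Lemma normc_opp z : normc (- z) = normc z.
Proof. exact: normcN. Qed.

Lemma normc_inv z : normc z^-1 = (normc z)^-1.
Proof. exact: normcV. Qed.

Lemma normc_sub z w : normc (z - w) <= normc z + normc w.
Proof. by rewrite -[X in _ <= _ + X]normc_opp normc_add. Qed.

Lemma normc_distC z w : normc (z - w) = normc (w - z).
Proof. by rewrite -normc_opp opprB. Qed.

Lemma normc_dist z w : normc z - normc w <= normc (z - w).
Proof. by rewrite lerBlDr -{1}(subrK w z) normc_add. Qed.

Lemma normc_eq0 z : (normc z == 0) = (z == 0).
Proof.
apply/eqP/eqP => [/eq0_normc // | ->]; exact: normc_zero.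
Qed.

Lemma normc_gt0 z : (0 < normc z) = (z != 0).
Proof. by rewrite lt_def normc_eq0 normc_ge0 andbT. Qed.

Lemma normc_exp z n : normc (z ^+ n) = normc z ^+ n.
Proof.
by elim: n => [|n IH]; rewrite ?expr0 ?normc_one // !exprS normc_mul IH.
Qed.

Lemma normc_sum (I : Type) (r : seq I) (P : pred I) (F : I -> C R) :
  normc (\sum_(i <- r | P i) F i) <= \sum_(i <- r | P i) normc (F i).
Proof.
elim/big_rec2: _ => [|i x y _ h]; first by rewrite normc_zero.
by rewrite (le_trans (normc_add _ _)) // lerD2l.
Qed.

Lemma normc_prod (I : Type) (r : seq I) (P : pred I) (F : I -> C R) :
  normc (\prod_(i <- r | P i) F i) = \prod_(i <- r | P i) normc (F i).
Proof.
elim/big_rec2: _ => [|i x y _ <-]; first exact: normc_one.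
by rewrite normc_mul.
Qed.

Lemma normc_natr n : normc (n%:R : C R) = n%:R.
Proof.
have -> : (n%:R : C R) = (n%:R : R)%:C%C by rewrite rmorph_nat.
by rewrite normc_real ger0_norm.
Qed.

Lemma normc_Re z : `|complex.Re z| <= normc z.
Proof.
case: z => a b /=; rewrite -sqrtr_sqr ler_sqrt ?addr_ge0 ?sqr_ge0 //.
by rewrite lerDl sqr_ge0.
Qed.

Lemma normc_Im z : `|complex.Im z| <= normc z.
Proof.
case: z => a b /=; rewrite -sqrtr_sqr ler_sqrt ?addr_ge0 ?sqr_ge0 //.
by rewrite lerDr sqr_ge0.
Qed.

Lemma normc_le_ReIm z : normc z <= `|complex.Re z| + `|complex.Im z|.
Proof.
case: z => a b /=; rewrite -[leRHS]ger0_norm ?addr_ge0 // -sqrtr_sqr.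
rewrite ler_sqrt ?sqr_ge0 // sqrrD !real_normK ?num_real //.
by rewrite lerD2r lerDl mulrn_wge0 // mulr_ge0.
Qed.

End modulus.

Section exponential.
Variable R : realType.
Implicit Types (x y t : R) (z w : C R).

Definition cis t : C R := Complex (cos t) (sin t).

Definition cexp x y : C R := (expR x)%:C%C * cis y.

Lemma cisD s t : cis (s + t) = cis s * cis t.
Proof.
rewrite /cis; apply/eqP; rewrite eq_complex /= cosD sinD eqxx /=.
by apply/eqP; ring.
Qed.

Lemma cis0 : cis 0 = 1.
Proof. by rewrite /cis cos0 sin0. Qed.

Lemma normc_cis t : normc (cis t) = 1.
Proof. by rewrite /= cos2Dsin2 sqrtr1. Qed.

Lemma cis_neq0 t : cis t != 0.
Proof. by rewrite -normc_gt0 normc_cis. Qed.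

Lemma cis2pi : cis (2 * pi) = 1.
Proof. by rewrite mulr_natl /cis cos2pi sin2pi. Qed.

Lemma cisMn t n : cis (n%:R * t) = cis t ^+ n.
Proof.
elim: n => [|n IH]; first by rewrite mul0r cis0 expr0.
by rewrite exprS -IH -cisD -{2}(mul1r t) -mulrDl nat1r.
Qed.

Lemma cis_polar z : exists2 t, 0 <= t <= 2 * pi & z = (normc z)%:C%C * cis t.
Proof.
have [->|z0] := eqVneq z 0.
  exists 0; first by rewrite lexx mulr_ge0 ?pi_ge0.
  by rewrite normc_zero mul0r.
have n0 : normc z != 0 by rewrite normc_eq0.
have np : 0 < normc z by rewrite normc_gt0.
have h1 : -1 <= complex.Re z / normc z <= 1.
  by rewrite -ler_norml normrM normfV (ger0_norm (ltW np)) ler_pdivrMr // mul1r normc_Re.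
have sq : complex.Re z ^+ 2 + complex.Im z ^+ 2 = normc z ^+ 2.
  by case: z {z0 n0 np h1} => a b; rewrite /= sqr_sqrtr // addr_ge0 ?sqr_ge0.
set t := acos (complex.Re z / normc z).
have ct : cos t = complex.Re z / normc z by rewrite acosK.
have st : sin t = `|complex.Im z| / normc z.
  rewrite sin_acos //; have -> : 1 - (complex.Re z / normc z) ^+ 2 = (complex.Im z /
    normc z) ^+ 2.
    apply: (mulfI (expf_neq0 2 n0)); rewrite mulrBr mulr1 -!exprMn.
    by rewrite !(mulrCA (normc z)) divff // !mulr1 -sq; ring.
  by rewrite sqrtr_sqr normrM normfV (ger0_norm (ltW np)).
have [t0 tpi] : 0 <= t /\ t <= pi by rewrite acos_ge0 // acos_lepi.
have zE s : cos s = complex.Re z / normc z -> sin s = complex.Im z / normc z ->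
    z = (normc z)%:C%C * cis s.
  move=> cs ss; apply/eqP; rewrite eq_complex /= cs ss !mul0r subr0 addr0.
  by rewrite !(mulrC (normc z)) !divfK // !eqxx.
have [i0|i0] := leP 0 (complex.Im z).
  exists t; first by rewrite t0 /=; have := pi_ge0 R; lra.
  by apply: zE; rewrite // st ger0_norm.
exists (2 * pi - t); first by have := pi_ge0 R; lra.
by apply: zE; rewrite mulr_natl ?cosB ?sinB cos2pi sin2pi mul0r mul1r ?addr0 // sub0r st
  ltr0_norm // mulNr opprK.
Qed.

Lemma cexpD x y x' y' : cexp (x + x') (y + y') = cexp x y * cexp x' y'.
Proof. by rewrite /cexp expRD cisD rmorphM /= mulrACA. Qed.

Lemma normc_cexp x y : normc (cexp x y) = expR x.
Proof. by rewrite normc_mul normc_cis mulr1 normc_real gtr0_norm // expR_gt0. Qed.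

End exponential.

Section goursat.
Variable R : realType.
Variables (a b : C R).
Implicit Types (g : nat -> nat -> C R) (G : R -> R -> C R).

(* Left Riemann sum of [g dz] along the boundary of a square of a grid whose
   horizontal and vertical steps are [a] and [b]. With all sample points at the
   lower ends of the steps it is additive under subdivision and vanishes exactly
   for affine [g]. *)
Definition contour g i j L : C R :=
  \sum_(l < L) (a * (g (i + l)%N j - g (i + l)%N (j + L)%N) +
                b * (g (i + L)%N (j + l)%N - g i (j + l)%N)).

Lemma contour_split g i j L : contour g i j (L + L) =
  contour g i j L + contour g (i + L) j L +
  contour g i (j + L) L + contour g (i + L) (j + L) L.
Proof.
rewrite /contour big_split_ord /= -!big_split /=.
by apply: eq_bigr => l _; rewrite !addnA; ring.
Qed.

Lemma contour_affine x y i j L :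
  contour (fun p q => x + y * (p%:R * a + q%:R * b)) i j L = 0.
Proof. by rewrite /contour big1 // => l _; rewrite !natrD; ring. Qed.

Lemma contourB g g' i j L :
  contour (fun p q => g p q - g' p q) i j L = contour g i j L - contour g' i j L.
Proof. by rewrite /contour -sumrB; apply: eq_bigr => l _; ring. Qed.

Lemma normc_contour_le g i j L e :
  (forall p q, (i <= p <= i + L)%N -> (j <= q <= j + L)%N -> normc (g p q) <= e) ->
  normc (contour g i j L) <= L%:R * (2 * (normc a + normc b) * e).
Proof.
move=> h; rewrite (le_trans (normc_sum _ _ _)) //.
rewrite -[L in leRHS]card_ord mulr_natl -sumr_const ler_sum // => l _.
have ll : (l <= L)%N by exact: ltnW.
have {}h p q : (p <= L)%N -> (q <= L)%N -> normc (g (i + p)%N (j + q)%N) <= e.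
  by move=> pL qL; apply: h; rewrite leq_addr leq_add2l.
have dist p q p' q' : (p <= L)%N -> (q <= L)%N -> (p' <= L)%N -> (q' <= L)%N ->
    normc (g (i + p)%N (j + q)%N - g (i + p')%N (j + q')%N) <= 2 * e.
  move=> pL qL pL' qL'; rewrite (le_trans (normc_sub _ _)) //.
  by rewrite mulr_natl mulr2n lerD // h.
have -> : 2 * (normc a + normc b) * e = normc a * (2 * e) + normc b * (2 * e).
  by ring.
rewrite (le_trans (normc_add _ _)) // !normc_mul lerD // ler_wpM2l ?normc_ge0 //.
  by have := dist l 0 l L; rewrite addn0; apply.
by have := dist L l 0 l; rewrite addn0; apply.
Qed.

Definition grid G m : nat -> nat -> C R :=
  fun i j => G (i%:R / 2 ^+ m) (j%:R / 2 ^+ m).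

Definition riemann G k n i j : C R :=
  ((2 ^+ (k + n))^-1)%:C%C *
    contour (grid G (k + n)) (i * 2 ^ n) (j * 2 ^ n) (2 ^ n).

Definition small_riemann G (e : R) k i j : Prop :=
  exists n0, forall n, (n0 <= n)%N -> normc (riemann G k n i j) <= e / 4 ^+ k.

Lemma riemann_split G k n i j : riemann G k n.+1 i j =
  riemann G k.+1 n i.*2 j.*2 + riemann G k.+1 n i.*2.+1 j.*2 +
  riemann G k.+1 n i.*2 j.*2.+1 + riemann G k.+1 n i.*2.+1 j.*2.+1.
Proof.
rewrite /riemann !addnS !addSn -!mulrDr; congr (_ * _).
rewrite !mulSn -!muln2 expnS -!mulnA mul2n -addnn contour_split.
by rewrite !(addnC (2 ^ n)%N).
Qed.

Lemma small_riemann_split G e k i j :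
  small_riemann G e k.+1 i.*2 j.*2 -> small_riemann G e k.+1 i.*2.+1 j.*2 ->
  small_riemann G e k.+1 i.*2 j.*2.+1 -> small_riemann G e k.+1 i.*2.+1 j.*2.+1 ->
  small_riemann G e k i j.
Proof.
move=> [n1 h1] [n2 h2] [n3 h3] [n4 h4].
exists (n1 + n2 + n3 + n4).+1 => -[//|n] hn.
have -> : e / 4 ^+ k = e / 4 ^+ k.+1 + e / 4 ^+ k.+1 + e / 4 ^+ k.+1 + e / 4 ^+ k.+1.
  by rewrite exprS; field; rewrite expf_neq0.
have {}hn : [/\ n1 <= n, n2 <= n, n3 <= n & n4 <= n]%N by split; lia.
case: hn => *; rewrite riemann_split.
do 3 (apply: (le_trans (normc_add _ _)); apply: lerD; last by auto).
by auto.
Qed.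

End goursat.

Lemma dyadic_nested (R : realType) (i : nat -> nat) :
  (forall k, (i k).*2 <= i k.+1 <= (i k).*2.+1)%N ->
  exists u : R, forall k, (i k)%:R / 2 ^+ k <= u <= (i k).+1%:R / 2 ^+ k.
Proof.
move=> hi; have p2 k : 0 < 2 ^+ k :> R by rewrite exprn_gt0.
pose lo k : R := (i k)%:R / 2 ^+ k; pose hi_ k : R := (i k).+1%:R / 2 ^+ k.
have loS k : lo k <= lo k.+1.
  rewrite /lo ler_pdivrMr // mulrAC ler_pdivlMr // exprS mulrA ler_pM2r //.
  by rewrite -natrM ler_nat muln2; case/andP: (hi k).
have hiS k : hi_ k.+1 <= hi_ k.
  rewrite /hi_ ler_pdivrMr // mulrAC ler_pdivlMr // exprS mulrA ler_pM2r //.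
  by rewrite -natrM ler_nat muln2 doubleS ltnS; case/andP: (hi k).
have lohi k : lo k <= hi_ k by rewrite ler_pM2r ?invr_gt0 // ler_nat.
have lo_mono : {homo lo : m n / (m <= n)%N >-> m <= n}.
  exact: homo_leq (@lexx _ _) (@le_trans _ _) loS.
have hi_mono m n : (m <= n)%N -> hi_ n <= hi_ m.
  elim: n => [|n IH]; first by rewrite leqn0 => /eqP->.
  by rewrite leq_eqVlt ltnS => /predU1P[-> //|/IH]; apply: le_trans.
have lo_hi m n : lo m <= hi_ n.
  apply: (@le_trans _ _ (lo (maxn m n))); first by rewrite lo_mono // leq_maxl.
  by apply: le_trans (lohi _) _; rewrite hi_mono // leq_maxr.
exists (sup (range lo)) => k; apply/andP; split.
  apply: ub_le_sup; last by exists k.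
  by exists (hi_ 0%N) => _ [m _ <-]; exact: lo_hi.
apply: ge_sup; first by exists (lo 0%N), 0%N.
by move=> _ [m _ <-]; exact: lo_hi.
Qed.

Section goursat_theorem.
Variable R : realType.
Variables (a b : C R) (G : R -> R -> C R).

(* The form [G dz], where [dz = a du + b dv], has in the point [(u, v)] of the
   unit square a coefficient that is differentiable with respect to [z]. *)
Definition square_derivable u v : Prop := exists y, forall e, 0 < e ->
  exists2 d, 0 < d & forall r u' v', r < d -> `|u' - u| <= r -> `|v' - v| <= r ->
  normc (G u' v' - G u v - y * ((u' - u)%:C%C * a + (v' - v)%:C%C * b)) <= e * r.

Lemma small_riemann_local u v e : square_derivable u v -> 0 < e ->
  exists k0, forall k i j, (k0 <= k)%N ->
    i%:R / 2 ^+ k <= u <= i.+1%:R / 2 ^+ k ->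
    j%:R / 2 ^+ k <= v <= j.+1%:R / 2 ^+ k -> small_riemann a b G e k i j.
Proof.
move=> [y hy] e0; have p2 k : 0 < 2 ^+ k :> R by rewrite exprn_gt0.
pose K := 2 * (normc a + normc b) + 1.
have K0 : 0 < K by rewrite ltr_wpDl // mulr_ge0 // addr_ge0 ?normc_ge0.
have [d d0 hd] := hy (e / K) (divr_gt0 e0 K0).
have [k0 hk0] : exists k0, (2 ^+ k0)^-1 < d.
  exists (Num.truncn d^-1).+1; rewrite invf_plt ?posrE //.
  rewrite (lt_le_trans (truncnS_gt _)) // -natrX ler_nat.
  by rewrite ltnW // ltn_expl.
exists k0 => k i j kk0 hu hv; exists 0 => n _.
have rd : (2 ^+ k)^-1 < d.
  by apply: le_lt_trans hk0; rewrite lef_pV2 ?posrE // ler_eXn2l // ltr1n.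
have near p q (w : R) : q%:R / 2 ^+ k <= w <= q.+1%:R / 2 ^+ k ->
    (q * 2 ^ n <= p <= q * 2 ^ n + 2 ^ n)%N ->
    `|p%:R / 2 ^+ (k + n) - w| <= (2 ^+ k)^-1.
  move=> /andP[w1 w2] /andP[p1 p3].
  have pl : q%:R / 2 ^+ k <= p%:R / 2 ^+ (k + n) :> R.
    rewrite ler_pdivrMr // mulrAC ler_pdivlMr // exprD mulrCA mulrC ler_pM2r //.
    by rewrite -natrX -natrM ler_nat.
  have pr : p%:R / 2 ^+ (k + n) <= q.+1%:R / 2 ^+ k :> R.
    rewrite ler_pdivrMr // mulrAC ler_pdivlMr // exprD mulrCA mulrC ler_pM2l //.
    by rewrite -natrX -natrM ler_nat mulSn addnC.
  have : q.+1%:R / 2 ^+ k = q%:R / 2 ^+ k + (2 ^+ k)^-1 :> R.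
    by rewrite -natr1 mulrDl mul1r.
  by rewrite ler_norml; lra.
pose m := (k + n)%N.
pose lin p q := (G u v - y * (u%:C%C * a + v%:C%C * b)) +
  (y * ((2 ^+ m)^-1)%:C%C) * (p%:R * a + q%:R * b).
have cE : contour a b (grid G m) (i * 2 ^ n) (j * 2 ^ n) (2 ^ n) =
  contour a b (fun p q => grid G m p q - lin p q) (i * 2 ^ n) (j * 2 ^ n) (2 ^ n).
  by rewrite contourB contour_affine subr0.
rewrite /riemann -/m cE normc_mul normc_real gtr0_norm ?invr_gt0 //.
apply: (@le_trans _ _ ((2 ^+ m)^-1 * ((2 ^ n)%:R * (2 * (normc a + normc b) * (e / K *
  (2 ^+ k)^-1))))).
  rewrite ler_pM2l ?invr_gt0 // normc_contour_le // => p q hp hq.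
  have := hd _ (p%:R / 2 ^+ m) (q%:R / 2 ^+ m) rd (near _ _ _ hu hp) (near _ _ _ hv hq).
  congr (normc _ <= _); rewrite /grid /lin !rmorphB !rmorphM /= !rmorph_nat.
  by ring.
have -> : e / 4 ^+ k = ((2 ^+ k)^-1 * (2 ^+ k)^-1) * e.
  by rewrite (_ : 4 = 2 * 2) ?exprMn ?invfM 1?mulrC // -natrM.
rewrite natrX /m exprD.
have [pk0 pn0] : (2 ^+ k != 0 :> R) /\ (2 ^+ n != 0 :> R) by split; apply: lt0r_neq0.
set x := normc a + normc b; rewrite -/x in K0 *.
have -> : (2 ^+ k * 2 ^+ n)^-1 * (2 ^+ n * (2 * x * (e / K * (2 ^+ k)^-1))) =
    ((2 ^+ k)^-1 * (2 ^+ k)^-1) * (2 * x * e / K) :> R.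
  by field; rewrite pk0 pn0 gt_eqF.
rewrite ler_pM2l ?mulr_gt0 ?invr_gt0 // ler_pdivrMr // mulrC ler_pM2l //.
by rewrite lerDl.
Qed.

Theorem goursat_square :
  (forall u v, 0 <= u <= 1 -> 0 <= v <= 1 -> square_derivable u v) ->
  forall e, 0 < e -> small_riemann a b G e 0 0 0.
Proof.
move=> hG e e0; apply: contrapT => bad0.
pose bad k (s : nat * nat) := ~ small_riemann a b G e k s.1 s.2.
have step (ks : nat * (nat * nat)) : exists s' : nat * nat, bad ks.1 ks.2 ->
    [/\ bad ks.1.+1 s', (ks.2.1.*2 <= s'.1 <= ks.2.1.*2.+1)%N &
      (ks.2.2.*2 <= s'.2 <= ks.2.2.*2.+1)%N].
  case: ks => k [i j] /=.
  have [g|] := pselect (small_riemann a b G e k i j); first by exists (0, 0)%N.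
  move=> nb; apply: contrapT => /forallNP h; apply: nb.
  apply: small_riemann_split; apply: contrapT => nb.
  - by apply: (h (i.*2, j.*2)) => _; rewrite /= !leqnn !leqnSn.
  - by apply: (h (i.*2.+1, j.*2)) => _; rewrite /= !leqnn !leqnSn.
  - by apply: (h (i.*2, j.*2.+1)) => _; rewrite /= !leqnn !leqnSn.
  - by apply: (h (i.*2.+1, j.*2.+1)) => _; rewrite /= !leqnn !leqnSn.
have [f hf] := choice step.
pose s := fix s k := if k is k'.+1 then f (k', s k') else (0, 0)%N.
have bads k : bad k (s k) by elim: k => [//|k IH]; case: (hf (k, s k) IH).
have hs k := hf (k, s k) (bads k).
have [u hu] : exists u : R, forall k, (s k).1%:R / 2 ^+ k <= u <= (s k).1.+1%:R / 2 ^+ k.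
  by apply: (dyadic_nested R (i := fun k => (s k).1)) => k; case: (hs k).
have [v hv] : exists v : R, forall k, (s k).2%:R / 2 ^+ k <= v <= (s k).2.+1%:R / 2 ^+ k.
  by apply: (dyadic_nested R (i := fun k => (s k).2)) => k; case: (hs k).
have u01 : 0 <= u <= 1 by have := hu 0; rewrite /= expr0 mul0r divr1.
have v01 : 0 <= v <= 1 by have := hv 0; rewrite /= expr0 mul0r divr1.
have [k0 hk0] := small_riemann_local (hG u v u01 v01) e0.
exact: bads k0 (hk0 _ _ _ (leqnn _) (hu k0) (hv k0)).
Qed.

End goursat_theorem.

Section complex_derivative.
Variable R : realType.
Implicit Types (h k : C R -> C R) (z t : C R) (P : {poly C R}).

Definition cderivable h z : Prop := exists y, forall e, 0 < e ->
  exists2 d, 0 < d & forall t, normc t < d ->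
    normc (h (z + t) - h z - y * t) <= e * normc t.

Lemma gt0_complexE (e : C R) : 0 < e -> e = (complex.Re e)%:C%C /\ 0 < complex.Re e.
Proof.
by case: e => x y; rewrite ltcE /= => /andP[/eqP -> x0].
Qed.

Lemma ltC_normc z (d : R) : (`|z| < d%:C%C :> C R) = (normc z < d).
Proof. by rewrite normC_normc ltcR. Qed.

Lemma leC_normc z (d : R) : (`|z| <= d%:C%C :> C R) = (normc z <= d).
Proof. by rewrite normC_normc lecR. Qed.

Lemma nbhs_normc z (A : set (C R)) : nbhs z A <->
  exists2 d : R, 0 < d & forall z', normc (z' - z) < d -> A z'.
Proof.
split=> [/nbhs_ballP[e /= /gt0_complexE[-> e0] h]|[d d0 h]].
  by exists (complex.Re e) => // z' hz'; apply: h; rewrite /ball /= distrC ltC_normc.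
apply/nbhs_ballP; exists d%:C%C => /=; first by rewrite ltcR.
by move=> z'; rewrite /ball /= distrC ltC_normc; apply: h.
Qed.

Lemma nbhs_row_normc N (z : 'rV[C R]_N) (A : set 'rV[C R]_N) : nbhs z A <->
  exists2 d : R, 0 < d & forall z' : 'rV[C R]_N, (forall i,
    normc (z' ord0 i - z ord0 i) < d) -> A z'.
Proof.
split=> [/nbhs_ballP[e /= /gt0_complexE[eE e0] h]|[d d0 h]].
  exists (complex.Re e) => // z' hz'; apply: h; split; first by rewrite eE ltcR.
  by move=> i j; rewrite eE /ball /= distrC ltC_normc ord1 hz'.
apply/nbhs_ballP; exists d%:C%C => /=; first by rewrite ltcR.
by move=> z' [_ hz]; apply: h => i; have := hz ord0 i; rewrite /ball /= distrC ltC_normc.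
Qed.

Lemma derivable_cderivable h z : derivable h z 1 -> cderivable h z.
Proof.
move=> /cvg_ex[/= y hy]; exists y => e e0.
have e0' : 0 < e%:C%C :> C R by rewrite ltcR.
move: hy => /(@cvgrPdist_le (C R) (C R) (C R) _ (dnbhs_filter 0) _ y) /(_ _ e0');
  rewrite near_withinE => /nbhs_normc[d d0 hd].
exists d => // t td; have [->|t0] := eqVneq t 0.
  by rewrite addr0 subrr mulr0 subrr normc_zero mulr0.
have := hd t; rewrite subr0 => /(_ td t0); rewrite leC_normc => le.
rewrite -ler_pdivrMr ?normc_gt0 // -normc_inv -normc_mul.
move: le; rewrite normc_distC; congr (normc _ <= _).
rewrite /shift /= [t *: 1]mulr1 [_ *: _]mulrC [t + z]addrC.
by rewrite [RHS]mulrBl; congr (_ - _); symmetry; apply: mulfK.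
Qed.

Lemma is_derive_approx (f : R -> R) (x0 df e : R) : is_derive x0 1 f df -> 0 < e ->
  exists2 d, 0 < d & forall x, `|x| < d -> `|f (x0 + x) - f x0 - df * x| <= e * `|x|.
Proof.
move=> [fd <-] e0; move/cvg_ex: fd => [/= y hy].
have -> : 'D_1 f x0 = y by apply: cvg_lim hy.
move/cvgrPdist_le: hy => /(_ _ e0); rewrite near_withinE => /nbhs_ballP[d /= d0 hd].
exists d => // t td; have [->|t0] := eqVneq t 0.
  by rewrite addr0 subrr mulr0 subrr normr0 mulr0.
have := hd t; rewrite /ball /= sub0r normrN => /(_ td t0) le.
rewrite -ler_pdivrMr ?normr_gt0 // -normfV -normrM.
move: le; rewrite distrC; congr (`|_| <= _).
rewrite /shift /= [t *: 1]mulr1 [_ *: _]mulrC [t + x0]addrC.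
by rewrite [RHS]mulrBl; congr (_ - _); symmetry; apply: mulfK.
Qed.

Lemma cexp_approx (e : R) : 0 < e -> exists2 d, 0 < d &
  forall x y, `|x| < d -> `|y| < d ->
    normc (cexp x y - 1 - Complex x y) <= e * (`|x| + `|y|).
Proof.
move=> e0; pose c := Num.min (e / 5) 1.
have c0 : 0 < c by rewrite lt_min divr_gt0 //=.
have ce : c <= e / 5 by rewrite ge_min lexx.
have c1 : c <= 1 by rewrite ge_min lexx orbT.
have [d1 d10 h1] := is_derive_approx (is_derive_expR 0) c0.
have [d2 d20 h2] := is_derive_approx (is_derive_cos 0) c0.
have [d3 d30 h3] := is_derive_approx (is_derive_sin 0) c0.
exists (Num.min (c / 2) (Num.min d1 (Num.min d2 d3))).
  by rewrite !lt_min d10 d20 d30 divr_gt0 //.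
move=> x y; rewrite !lt_min => /and4P[xc x1 _ _] /and4P[_ _ y2 y3].
have := h1 _ x1; have := h2 _ y2; have := h3 _ y3.
rewrite !add0r expR0 cos0 sin0 !mul1r oppr0 mul0r !(subr0, addr0) => s3 s2 s1.
have ab : `|expR x - 1| <= c.
  have -> : expR x - 1 = (expR x - 1 - x) + x by ring.
  apply: (le_trans (ler_normD _ _)); have := normr_ge0 x; nra.
have e2 : `|expR x| <= 2.
  have -> : expR x = (expR x - 1) + 1 by ring.
  by apply: (le_trans (ler_normD _ _)); rewrite normr1; lra.
apply: (le_trans (normc_le_ReIm _)); rewrite /= !mul0r subr0 addr0.
set X := `|x| in ab xc s1 *; set Y := `|y| in s2 s3 *.
have re : `|expR x * cos y - 1 - x| <= c * X + 2 * (c * Y).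
  have -> : expR x * cos y - 1 - x = (expR x - 1 - x) + expR x * (cos y - 1) by ring.
  apply: (le_trans (ler_normD _ _)); rewrite normrM lerD //.
  by apply: ler_pM.
have im : `|expR x * sin y - 0 - y| <= 2 * (c * Y) + c * Y.
  have -> : expR x * sin y - 0 - y = expR x * (sin y - y) + (expR x - 1) * y by ring.
  apply: (le_trans (ler_normD _ _)); rewrite !normrM lerD //.
    by apply: ler_pM.
  by rewrite ler_wpM2r /Y.
have [X0 Y0] : 0 <= X /\ 0 <= Y by split; apply: normr_ge0.
apply: (le_trans (lerD re im)).
have := ler_wpM2r X0 ce; have := ler_wpM2r Y0 ce; nra.
Qed.

End complex_derivative.

Section cauchy_estimate.
Variable R : realType.
Implicit Types (h k : C R -> C R) (z t : C R) (P : {poly C R}).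

Lemma cderivable_cexp k (A B T u v : R) : 0 < A -> 0 < T ->
  cderivable k (cexp (A * u + B) (T * v)) ->
  square_derivable A%:C%C (Complex 0 T)
    (fun u v => k (cexp (A * u + B) (T * v))) u v.
Proof.
move=> A0 T0 [y hy]; set z0 := cexp _ _ in hy *.
pose K := normc z0; have K0 : 0 < K by rewrite /K normc_cexp expR_gt0.
pose S := A + T; have S0 : 0 < S by rewrite addr_gt0.
pose Y := normc y; have Y0 : 0 <= Y by rewrite normc_ge0.
have KS0 : 0 < K * S by rewrite mulr_gt0.
exists (y * z0) => e e0.
have YKS0 : 0 < 2 * (Y * (K * S) + 1).
  by rewrite mulr_gt0 // ltr_wpDl // mulr_ge0 // ltW.
pose e1 := Num.min 1 (e / (2 * (Y * (K * S) + 1))).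
have e10 : 0 < e1 by rewrite lt_min ltr01 divr_gt0.
have e11 : e1 <= 1 by rewrite ge_min lexx.
have e1e : Y * (K * S) * e1 <= e / 2.
  have : e1 * (2 * (Y * (K * S) + 1)) <= e by rewrite -ler_pdivlMr // ge_min lexx orbT.
  by move: e10; set x := Y * _; lra.
have [d1 d10 h1] := cexp_approx e10.
have e20 : 0 < e / (4 * (K * S)) by rewrite divr_gt0 // mulr_gt0.
have [d2 d20 h2] := hy _ e20.
exists (Num.min (d1 / S) (d2 / (2 * (K * S)))).
  by rewrite lt_min !divr_gt0 // mulr_gt0.
move=> r u' v'; rewrite lt_min ltr_pdivlMr // ltr_pdivlMr ?mulr_gt0 //.
move=> /andP[rd1 rd2] ur vr.
have r0 : 0 <= r by apply: le_trans ur.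
pose X := A * (u' - u); pose Z := T * (v' - v).
have Xr : `|X| <= A * r by rewrite normrM gtr0_norm // ler_pM2l.
have Zr : `|Z| <= T * r by rewrite normrM gtr0_norm // ler_pM2l.
have XZ : `|X| + `|Z| <= S * r by rewrite /S mulrDl lerD.
have X0 : 0 <= `|X| by []. have Z0 : 0 <= `|Z| by [].
have Xd : `|X| < d1 by rewrite (le_lt_trans _ rd1) //
  (le_trans _ (le_trans XZ _)) ?lerDl // mulrC.
have Zd : `|Z| < d1 by rewrite (le_lt_trans _ rd1) //
  (le_trans _ (le_trans XZ _)) ?lerDr // mulrC.
set w := Complex X Z; set E := cexp X Z - 1.
have Ew : normc (E - w) <= e1 * (S * r).
  by rewrite (le_trans (h1 _ _ Xd Zd)) // ler_pM2l.
have wr : normc w <= S * r by rewrite (le_trans (normc_le_ReIm _)).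
have Sr : 0 <= S * r by rewrite mulr_ge0 // ltW.
have Er : normc E <= 2 * (S * r).
  rewrite -(subrK w E) (le_trans (normc_add _ _)) // mulr_natl mulr2n lerD //.
  by rewrite (le_trans Ew) // ler_piMl.
have tr : normc (z0 * E) <= 2 * (K * S) * r.
  by rewrite normc_mul (_ : 2 * (K * S) * r = K * (2 * (S * r))) ?ler_pM2l //; ring.
have -> : cexp (A * u' + B) (T * v') = z0 + z0 * E.
  rewrite (_ : z0 + z0 * E = z0 * cexp X Z); last by rewrite /E; ring.
  by rewrite -cexpD /X /Z; congr cexp; ring.
have td : normc (z0 * E) < d2 by rewrite (le_lt_trans tr) // mulrC.
have -> : (u' - u)%:C%C * A%:C%C + (v' - v)%:C%C * Complex 0 T = w.
  by apply/eqP; rewrite eq_complex /= /X /Z; apply/andP; split; apply/eqP; ring.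
have -> : k (z0 + z0 * E) - k z0 - y * z0 * w =
    (k (z0 + z0 * E) - k z0 - y * (z0 * E)) + y * z0 * (E - w) by ring.
rewrite (le_trans (normc_add _ _)) //.
have p1 := h2 _ td.
have p2 : normc (y * z0 * (E - w)) <= e / 2 * r.
  have YK0 : 0 <= Y * K by rewrite mulr_ge0 // ltW.
  rewrite normc_mul (normc_mul y); apply: (le_trans (ler_wpM2l YK0 Ew)).
  rewrite (_ : Y * K * (e1 * (S * r)) = Y * (K * S) * e1 * r); last by ring.
  by rewrite ler_wpM2r.
rewrite [e]splitr mulrDl lerD // (le_trans p1) //.
rewrite (le_trans (ler_wpM2l (ltW e20) tr)) // le_eqVlt; apply/orP; left.
by apply/eqP; field; rewrite ?gt_eqF.
Qed.

Lemma cis_neq1 (t : R) : 0 < t < 2 * pi -> cis t != 1.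
Proof.
move=> t02; rewrite eq_complex /= negb_and; apply/orP; left.
have s0 : 0 < sin (t / 2) by rewrite sin_gt0_pi //; lra.
have -> : cos t = cos (t / 2 + t / 2) by congr cos; lra.
rewrite cosD -expr2 cos2sin2 -expr2; apply/eqP.
by have := exprn_gt0 2 s0; lra.
Qed.

Definition root_of_unity n : C R := cis (2 * pi / n%:R).

Lemma root_of_unity_exp n : (0 < n)%N -> root_of_unity n ^+ n = 1.
Proof.
move=> n0; rewrite -cisMn mulrCA divff ?mulr1 ?cis2pi //.
by rewrite pnatr_eq0 -lt0n.
Qed.

Lemma root_of_unity_prim n : (0 < n)%N -> n.-primitive_root (root_of_unity n).
Proof.
move=> n0; apply/andP; split=> //; apply/forallP => -[i ilt] /=; rewrite unity_rootE.
have [->|ni] := eqVneq i.+1 n; first by rewrite root_of_unity_exp // eqxx.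
apply/eqP/negbTE; rewrite -cisMn cis_neq1 //.
have n0' : 0 < n%:R :> R by rewrite ltr0n.
have pp : 0 < 2 * pi :> R by rewrite mulr_gt0 // pi_gt0.
rewrite mulr_gt0 ?divr_gt0 ?ltr0n //= mulrA ltr_pdivrMr // mulrC ltr_pM2l //.
by rewrite ltr_nat ltn_neqAle ni.
Qed.

Lemma normc_root_of_unity n : normc (root_of_unity n) = 1.
Proof. exact: normc_cis. Qed.

Lemma sum_root_of_unity n j m : (j < n)%N -> (m < n)%N ->
  \sum_(k < n) root_of_unity n ^+ (k * j) / root_of_unity n ^+ (k * m) =
  if j == m then n%:R else 0.
Proof.
move=> jn mn; have n0 : (0 < n)%N by exact: leq_ltn_trans jn.
set x := root_of_unity n; have prim : n.-primitive_root x := root_of_unity_prim n0.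
have x0 : x != 0 by exact: cis_neq0.
rewrite (eq_bigr (fun k : 'I_n => (x ^+ j / x ^+ m) ^+ k)); last first.
  by move=> k _; rewrite expr_div_n -!exprM !(mulnC k).
case: eqVneq => [->|jm].
  rewrite divff ?expf_neq0 // (eq_bigr (fun=> 1)) => [|k _]; last by rewrite expr1n.
  by rewrite sumr_const card_ord.
have q1 : x ^+ j / x ^+ m != 1.
  rewrite -subr_eq0 -(divff (expf_neq0 m x0)) -mulrBl mulf_neq0 ?invr_neq0 ?expf_neq0 //.
  by rewrite subr_eq0 (eq_prim_root_expr prim) !modn_small.
apply/eqP; have := subrX1 (x ^+ j / x ^+ m) n.
rewrite expr_div_n -!exprM !(mulnC _ n) !exprM root_of_unity_exp // !expr1n divr1 subrr.
by move/esym/eqP; rewrite mulf_eq0 subr_eq0 (negbTE q1).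
Qed.

Lemma coef_root_of_unity_mean P n m r : (size P <= n)%N -> (m < n)%N -> r != 0 ->
  P`_m = n%:R^-1 * \sum_(k < n) P.[r * root_of_unity n ^+ k] / (r * root_of_unity n ^+
    k) ^+ m.
Proof.
move=> Pn mn r0; have n0 : n%:R != 0 :> C R by rewrite pnatr_eq0 -lt0n (leq_ltn_trans _
  mn).
apply: (mulfI n0); rewrite mulrA divff // mul1r.
under eq_bigr do rewrite (horner_coef_wide _ Pn) mulr_suml.
rewrite exchange_big /=.
rewrite (eq_bigr (fun j : 'I_n => if j == m :> nat then P`_m * n%:R else 0)) => [|j _].
  by rewrite -big_mkcond (big_pred1 (Ordinal mn)) /= 1?mulrC // => i; rewrite -val_eqE.
rewrite (eq_bigr (fun k : 'I_n => P`_j * r ^+ j / r ^+ m *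
    (root_of_unity n ^+ (k * j) / root_of_unity n ^+ (k * m)))) => [|k _]; last first.
  by rewrite !exprMn -!exprM invfM; ring.
rewrite -mulr_sumr sum_root_of_unity //; case: eqP => [->|_]; last by rewrite mulr0.
by rewrite mulfK // expf_neq0.
Qed.

Lemma derivable_div_expn h z m : derivable h z 1 -> z != 0 ->
  derivable (fun l => h l / l ^+ m) z 1.
Proof.
move=> hz z0; have dX : derivable (fun l : C R => l ^+ m) z 1.
  have := @derivableX (C R) (C R) id m z 1 (@derivable_id (C R) _ z 1).
  have -> : (id : C R -> C R) ^+ m = (fun l : C R => l ^+ m) => //.
  by apply/funext => l; elim: m => [|m IH]; rewrite ?expr0 // !exprS -IH.
have dV : derivable (fun l : C R => (l ^+ m)^-1) z 1.
  by apply: (@derivableV (C R) (C R) (fun l => l ^+ m) z 1 _ dX); rewrite expf_neq0.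
exact: (@derivableM (C R) (C R) h (fun l => (l ^+ m)^-1) z 1 hz dV).
Qed.

(* In the coordinates [l = cexp (A * (u - 1)) (2 * pi * v)] the annulus
   [eps <= |l| <= 1] is the unit square. There Goursat's theorem for
   [h l / l ^+ m], which is periodic in [v], equates the limits of its means over
   the two bounding circles, and the mean over the inner one is nearly [P`_m]. *)
Theorem cauchy_coef_le h P m (M eps e' : R) :
  (forall l, normc l < 2 -> derivable h l 1) ->
  (forall l, normc l < 2 -> normc (h l) <= M) ->
  0 < eps < 1 -> (forall l, normc l = eps -> normc (h l - P.[l]) <= e') ->
  normc P`_m <= M + e' / eps ^+ m.
Proof.
move=> dh hM /andP[eps0 eps1] hP; apply/ler_addgt0Pr => e e0.
pose A := - ln eps; have A0 : 0 < A by rewrite oppr_gt0 ln_lt0 // eps0.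
pose T : R := 2 * pi; have T0 : 0 < T by rewrite mulr_gt0 // pi_gt0.
pose k l := h l / l ^+ m.
pose G (u v : R) := k (cexp (A * u - A) (T * v)).
have hG u v : 0 <= u <= 1 -> 0 <= v <= 1 -> square_derivable A%:C%C (Complex 0 T) G u v.
  move=> /andP[u0 u1] _; apply: cderivable_cexp => //; apply: derivable_cderivable.
  apply: derivable_div_expn; last by rewrite -normc_gt0 normc_cexp expR_gt0.
  apply: dh; rewrite normc_cexp (@le_lt_trans _ _ 1) ?ltr1n //.
  by rewrite -expR0 ler_expR; nra.
have [n0 hn] := goursat_square hG (mulr_gt0 T0 e0).
pose n := (n0 + size P + m)%N; pose L := (2 ^ n)%N.
have nL : (n < L)%N by exact: ltn_expl.
have L0 : 0 < L%:R :> R by rewrite ltr0n expn_gt0.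
have LC : (L%:R^-1)%:C%C = L%:R^-1 :> C R by rewrite fmorphV rmorph_nat.
have LE : (L%:R)%:C%C = L%:R :> C R by rewrite rmorph_nat.
have n0n : (n0 <= n)%N by rewrite /n -addnA leq_addr.
have := hn n n0n.
rewrite expr0 divr1 /riemann add0n -[2 ^+ n]natrX -/L !mul0n LC /contour.
pose z r (j : nat) := r%:C%C * root_of_unity L ^+ j.
have gridE (i : nat) (j : nat) : grid G n i j = k (cexp (A * (i%:R / L%:R) - A) (T *
  (j%:R / L%:R))).
  by rewrite /grid /G -natrX.
have cisE (j : nat) : cis (T * (j%:R / L%:R)) = root_of_unity L ^+ j.
  by rewrite /root_of_unity -cisMn; congr cis; rewrite /T; ring.
have LL : L%:R / L%:R = 1 :> R by rewrite divff // gt_eqF.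
rewrite (eq_bigr (fun j : 'I_L => Complex 0 T * (k (z 1 j) - k (z eps j)))); last first.
  move=> j _; rewrite !add0n !gridE /cexp !cisE LL mulr0n mul0r !mulr1 mulr0.
  rewrite root_of_unity_exp ?expn_gt0 // mulr1 subrr mulr0 add0r.
  rewrite subrr sub0r opprK.
  by rewrite expR0 lnK // posrE.
rewrite -mulr_sumr mulrCA normc_mul.
have -> : normc (Complex 0 T) = T by rewrite /= expr0n /= add0r sqrtr_sqr gtr0_norm.
rewrite ler_pM2l // sumrB mulrBr => diff.
have szP : (size P <= L)%N by rewrite (leq_trans _ (ltnW nL)) //
  /n -addnA (leq_trans (leq_addr m _)) // leq_addl.
have mL : (m < L)%N by rewrite (leq_ltn_trans _ nL) // leq_addl.
have epsC : eps%:C%C != 0 :> C R by rewrite -normc_gt0 normc_real gtr0_norm.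
have nz r j : 0 < r -> normc (z r j) = r.
  by move=> r0; rewrite normc_mul normc_exp normc_root_of_unity expr1n mulr1 normc_real
    gtr0_norm.
have mean_le (F : nat -> C R) (B : R) : (forall j, normc (F j) <= B) ->
    normc (L%:R^-1 * \sum_(j < L) F j) <= B.
  move=> FB; rewrite normc_mul normc_inv normc_natr ler_pdivrMl //.
  rewrite (le_trans (normc_sum _ _ _)) // -[L in leRHS]card_ord mulr_natl -sumr_const.
  by rewrite ler_sum.
have out : normc (L%:R^-1 * \sum_(j < L) k (z 1 j)) <= M.
  apply: (mean_le (fun j => k (z 1 j))) => j.
  by rewrite /k normc_mul normc_inv normc_exp nz // expr1n divr1 hM // nz // ltr1n.
have inn : normc (L%:R^-1 * \sum_(j < L) k (z eps j) - P`_m) <= e' / eps ^+ m.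
  rewrite (coef_root_of_unity_mean szP mL epsC) -mulrBr -sumrB.
  apply: (mean_le (fun j => k (z eps j) - P.[z eps j] / (z eps j) ^+ m)) => j.
  rewrite /k -mulrBl normc_mul normc_inv normc_exp nz //.
  by rewrite ler_pM2r ?invr_gt0 ?exprn_gt0 // hP // nz.
move: diff out inn; set X := _ * _; set Y := _ * _ => XY X_le YP.
have -> : P`_m = X - (X - Y) - (Y - P`_m) by ring.
rewrite (le_trans (normc_sub _ _)) // addrAC lerD //.
by rewrite (le_trans (normc_sub _ _)) // lerD.
Qed.

End cauchy_estimate.

Section multiindex_sums.
Variable R : realType.

Lemma sum_fsetD (V : zmodType) (T : choiceType) (F : T -> V) (A B : {fset T}) :
  (A `<=` B)%fset ->
  \sum_(x <- B) F x = \sum_(x <- A) F x + \sum_(x <- (B `\` A)%fset) F x.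
Proof.
move=> /fsubsetP AB; rewrite -big_cat /=; apply: perm_big; apply: uniq_perm => [||x].
- exact: fset_uniq.
- rewrite cat_uniq !fset_uniq /= andbT; apply/hasPn => x.
  by rewrite inE => /andP[].
- rewrite mem_cat inE; case: (boolP (x \in A)) => [xA|xA] /=; last by [].
  exact: AB.
Qed.

Lemma ler_sum_fset (T : choiceType) (F : T -> R) (A B : {fset T}) :
  (forall x, 0 <= F x) -> (A `<=` B)%fset ->
  \sum_(x <- A) F x <= \sum_(x <- B) F x.
Proof. by move=> F0 AB; rewrite (sum_fsetD F AB) lerDl sumr_ge0. Qed.

Variable N : nat.
Implicit Types (d : {ffun 'I_N -> nat} -> C R) (A : {fset {ffun 'I_N -> nat}}).

Lemma multiindex_bound A : exists2 L, (0 < L)%N & forall J i, J \in A -> (J i < L)%N.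
Proof.
exists (\max_(J <- A) \max_i J i).+1 => // J i JA; rewrite ltnS.
apply: (@leq_trans (\max_i J i)); first exact: leq_bigmax.
by apply: (leq_bigmax_seq (F := fun J : {ffun 'I_N -> nat} => \max_i J i)).
Qed.

Lemma torus_coef_le d A (B : R) J0 : J0 \in A ->
  (forall w : 'I_N -> C R, (forall i, normc (w i) = 1) ->
    normc (\sum_(J <- A) d J * \prod_i w i ^+ J i) <= B) ->
  normc (d J0) <= B.
Proof.
move=> J0A hB; have [L L0 AL] := multiindex_bound A.
pose x : C R := root_of_unity R L.
pose f (k : {ffun 'I_N -> 'I_L}) := \prod_i (x ^+ (k i * J0 i))^-1.
pose S k := \sum_(J <- A) d J * \prod_i (x ^+ k i) ^+ J i.
have xn n : normc (x ^+ n) = 1 by rewrite normc_exp normc_root_of_unity expr1n.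
have inner J : J \in A ->
    \sum_(k : {ffun 'I_N -> 'I_L}) d J * \prod_i (x ^+ k i) ^+ J i * f k =
    if J == J0 then d J0 * L%:R ^+ N else 0.
  move=> JA; under eq_bigr do rewrite -mulrA -big_split /=.
  rewrite -mulr_sumr -(bigA_distr_bigA (fun i (k : 'I_L) => (x ^+ k) ^+ J i / x ^+ (k *
    J0 i))) /=.
  case: eqVneq => [->|JJ0].
    rewrite (eq_bigr (fun=> L%:R)) ?prodr_const ?card_ord // => i _.
    under eq_bigr do rewrite -exprM.
    by rewrite sum_root_of_unity ?AL // eqxx.
  have [i Ji] : exists i, J i != J0 i.
    by apply/existsP; apply: contraNT JJ0 => /existsPn h; apply/eqP/ffunP => i;
      apply/eqP/negbNE/h.
  rewrite (bigD1 i) //=; under eq_bigr do rewrite -exprM.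
  by rewrite sum_root_of_unity ?AL // (negbTE Ji) mul0r mulr0.
have mean : \sum_(k : {ffun 'I_N -> 'I_L}) S (fun i => k i) * f k = d J0 * L%:R ^+ N.
  under eq_bigr do rewrite /S mulr_suml.
  rewrite exchange_big /= big_seq (eq_bigr _ (fun J JA => inner J JA)) -big_seq.
  rewrite (big_fsetD1 J0) //= eqxx big_seq big1 ?addr0 // => J.
  by rewrite !inE => /andP[/negbTE ->].
have LN0 : 0 < L%:R ^+ N :> R by rewrite exprn_gt0 // ltr0n.
rewrite -(ler_pM2r LN0) -normc_natr -[in leLHS]normc_exp -normc_mul -mean.
rewrite (le_trans (normc_sum _ _ _)) //.
apply: (@le_trans _ _ (\sum_(k : {ffun 'I_N -> 'I_L}) B)).
  apply: ler_sum => k _; rewrite normc_mul /f normc_prod [X in _ * X]big1 ?mulr1 => [|i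
    _].
    by apply: hB => i; exact: xn.
  by rewrite normc_inv xn invr1.
by rewrite sumr_const card_ffun !card_ord normc_natr -natrX [leRHS]mulr_natr.
Qed.

Lemma sum_geometric_le (t : R) L : 0 <= t < 1 -> \sum_(k < L) t ^+ k <= (1 - t)^-1.
Proof.
move=> /andP[t0 t1]; have t1' : 0 < 1 - t by rewrite subr_gt0.
rewrite -[leRHS]mul1r ler_pdivlMr // mulrC -opprB mulNr -subrX1 opprB.
by rewrite lerBlDr lerDl exprn_ge0.
Qed.

Lemma sum_prod_geometric_le (t : 'I_N -> R) A : (forall i, 0 <= t i < 1) ->
  \sum_(J <- A) \prod_i t i ^+ J i <= \prod_i (1 - t i)^-1.
Proof.
move=> t01; have [L L0 AL] := multiindex_bound A.
pose lo (k : {ffun 'I_N -> 'I_L}) : {ffun 'I_N -> nat} := [ffun i => k i : nat].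
pose B := [fset J in codom lo]%fset.
have AB : (A `<=` B)%fset.
  apply/fsubsetP => J JA; rewrite !inE; apply/codomP.
  exists [ffun i => Ordinal (AL J i JA)].
  by apply/ffunP => i; rewrite !ffunE.
have F0 (J : {ffun 'I_N -> nat}) : 0 <= \prod_i t i ^+ J i.
  by rewrite prodr_ge0 // => i _; rewrite exprn_ge0 //; case/andP: (t01 i).
apply: (le_trans (ler_sum_fset F0 AB)).
have lo_inj : injective lo.
  by move=> k k' /ffunP e; apply/ffunP => i; apply: val_inj; have := e i; rewrite !ffunE.
have -> : \sum_(J <- B) \prod_i t i ^+ J i = \sum_k \prod_i t i ^+ (lo k) i.
  rewrite -[RHS]big_enum -(big_map lo xpredT (fun J : {ffun 'I_N -> nat} => \prod_i t i
    ^+ J i)).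
  apply: perm_big; apply: uniq_perm => [||J].
  - exact: fset_uniq.
  - by rewrite map_inj_uniq // enum_uniq.
  - by rewrite !inE.
rewrite (eq_bigr (fun k : {ffun 'I_N -> 'I_L} => \prod_i t i ^+ k i)) => [|k _];
  last first.
  by apply: eq_bigr => i _; rewrite ffunE.
rewrite -(bigA_distr_bigA (fun i (k : 'I_L) => t i ^+ k)) /=.
apply: ler_prod => i _; rewrite sum_geometric_le // andbT sumr_ge0 // => k _.
by rewrite exprn_ge0 //; case/andP: (t01 i).
Qed.

End multiindex_sums.

Section power_series_domain.
Variables (R : realType) (N : nat) (c : {ffun 'I_N -> nat} -> C R).
Implicit Types (A : {fset {ffun 'I_N -> nat}}) (z q : 'rV[C R]_N) (e : 'I_N -> R).

Definition abs_term e (J : {ffun 'I_N -> nat}) : R := normc (c J) * \prod_i e i ^+ J i.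

Definition abs_bounded e : Prop := exists B, forall A, \sum_(J <- A) abs_term e J <= B.

Lemma abs_term_ge0 e J : (forall i, 0 <= e i) -> 0 <= abs_term e J.
Proof.
by move=> e0; rewrite mulr_ge0 ?normc_ge0 // prodr_ge0 // => i _; rewrite exprn_ge0.
Qed.

Lemma abs_term_le e e' J : (forall i, 0 <= e i <= e' i) -> abs_term e J <= abs_term e' J.
Proof.
move=> ee; rewrite ler_wpM2l ?normc_ge0 //; apply: ler_prod => i _.
by have /andP[e0 ee'] := ee i; rewrite exprn_ge0 //= lerXn2r // nnegrE // (le_trans e0).
Qed.

Lemma normc_power_term z J :
  normc (power_term c z J) = abs_term (fun i => normc (z ord0 i)) J.
Proof.
rewrite normc_mul normc_prod; congr (_ * _).
by apply: eq_bigr => i _; rewrite normc_exp.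
Qed.

Lemma converges_absolutelyP z :
  converges_absolutely c z <-> abs_bounded (fun i => normc (z ord0 i)).
Proof.
have absE J : `|(normc (power_term c z J))%:E|%E = (abs_term (fun i => normc (z ord0
  i)) J)%:E.
  by rewrite /= ger0_norm ?normc_ge0 // normc_power_term.
rewrite /converges_absolutely /summable; split=> [fin|[B hB]].
  exists (fine (\esum_(J in [set: {ffun 'I_N -> nat}]) `|(normc (power_term c z
    J))%:E|%E)) => A.
  rewrite -lee_fin fineK; last first.
    rewrite ge0_fin_numE //; first by apply: esum_ge0.
  apply: esum_ge; exists [set` A]; first by split => //; exact: finite_fset.
  rewrite -fsbig_seq ?fset_uniq //.
  by rewrite (eq_bigr _ (fun J _ => absE J)) sumEFin.
apply: (@le_lt_trans _ _ B%:E); last exact: ltry.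
apply: ge_ereal_sup => _ [X [finX _] <-].
by rewrite fsbig_finite //= (eq_bigr _ (fun J _ => absE J)) sumEFin lee_fin.
Qed.

Lemma abs_bounded_le e e' : (forall i, 0 <= e i <= e' i) -> abs_bounded e' ->
  abs_bounded e.
Proof.
move=> ee [B hB]; exists B => A; apply: le_trans (hB A).
by apply: ler_sum => J _; apply: abs_term_le.
Qed.

Lemma normc_scaled_polar (x t : R) : 0 <= x -> normc (x%:C%C * cis t) = x.
Proof. by move=> x0; rewrite normc_mul normc_cis mulr1 normc_real ger0_norm. Qed.

Lemma domain_of_convergenceP q : domain_of_convergence c q <->
  exists2 e, (forall i, normc (q ord0 i) < e i) & abs_bounded e.
Proof.
split.
  rewrite /domain_of_convergence /interior /= => /nbhs_row_normc[d d0 hd].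
  have polar i := cis_polar (q ord0 i).
  pose t i := sval (cid2 (polar i)).
  have tE i : q ord0 i = (normc (q ord0 i))%:C%C * cis (t i) by rewrite /t; case: cid2.
  pose e i := normc (q ord0 i) + d / 2.
  have e0 i : 0 <= e i by rewrite addr_ge0 ?normc_ge0 // divr_ge0 ?ltW.
  pose q' : 'rV[C R]_N := \row_i ((e i)%:C%C * cis (t i)).
  exists e => [i|]; first by rewrite ltrDl divr_gt0.
  have eE : (fun i => normc (q' ord0 i)) = e.
    by apply/funext => i; rewrite mxE normc_scaled_polar.
  rewrite -eE; apply/converges_absolutelyP; apply: hd => i.
  rewrite mxE [q ord0 i]tE -mulrBl -rmorphB.
  rewrite (_ : e i - normc (q ord0 i) = d / 2); last by rewrite /e; ring.
  by rewrite normc_scaled_polar; lra.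
move=> [e he bnd]; rewrite /domain_of_convergence /interior /=.
have : nbhs q [set z : 'rV[C R]_N | forall i, normc (z ord0 i) < e i].
  apply: (@filter_forall _ _ (fun i (z : 'rV[C R]_N) => normc (z ord0 i) < e i) _
    (nbhs_filter q)) => i.
  apply/nbhs_row_normc; exists (e i - normc (q ord0 i)).
    by rewrite subr_gt0.
  move=> z /(_ i) hz; have := normc_dist (z ord0 i) (q ord0 i); lra.
apply: filterS => z hz; apply/converges_absolutelyP; apply: abs_bounded_le bnd => i.
by rewrite normc_ge0 ltW.
Qed.

End power_series_domain.

Section nets.
Variable R : realType.

Lemma real_net_limit (T : choiceType) (x : {fset T} -> R) :
  (forall e, 0 < e -> exists A0, forall A, (A0 `<=` A)%fset -> `|x A - x A0| <= e) ->
  exists l, forall A0 e, (forall A, (A0 `<=` A)%fset -> `|x A - x A0| <= e) -> `|l - x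
    A0| <= e.
Proof.
move=> cx; pose S := [set y | exists A1, forall A, (A1 `<=` A)%fset -> y <= x A].
have ub A0 e : (forall A, (A0 `<=` A)%fset -> `|x A - x A0| <= e) -> ubound S (x A0 + e).
  move=> h y [A1 hA1]; have := hA1 (A0 `|` A1)%fset (fsubsetUr _ _).
  by have := h (A0 `|` A1)%fset (fsubsetUl _ _); rewrite ler_norml; lra.
have inS A0 e : (forall A, (A0 `<=` A)%fset -> `|x A - x A0| <= e) -> S (x A0 - e).
  by move=> h; exists A0 => A /h; rewrite ler_norml; lra.
exists (sup S) => A0 e h.
have h1 : sup S <= x A0 + e.
  by apply: ge_sup; [exists (x A0 - e); exact: inS | exact: ub].
have h2 : x A0 - e <= sup S.
  by apply: ub_le_sup; [exists (x A0 + e); exact: ub | exact: inS].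
by rewrite ler_norml; lra.
Qed.

End nets.

Section power_series_approximation.
Variables (R : realType) (N : nat) (c : {ffun 'I_N -> nat} -> C R).
Implicit Types (A : {fset {ffun 'I_N -> nat}}) (z q : 'rV[C R]_N) (e : 'I_N -> R).

Lemma abs_bounded_tail e eta : (forall i, 0 <= e i) -> abs_bounded c e -> 0 < eta ->
  exists A0, forall A, (A0 `<=` A)%fset ->
    \sum_(J <- (A `\` A0)%fset) abs_term c e J <= eta.
Proof.
move=> e0 [B hB] eta0; pose S := range (fun A => \sum_(J <- A) abs_term c e J).
have hS : has_sup S.
  by split; [exists (\sum_(J <- fset0) abs_term c e J), fset0 | exists B => _ [A _ <-]].
have [_ [A0 _ <-] hA0] := sup_adherent eta0 hS.
exists A0 => A A0A; have := sum_fsetD (abs_term c e) A0A.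
have : \sum_(J <- A) abs_term c e J <= sup S by apply: ub_le_sup; [case: hS | exists A].
lra.
Qed.

Lemma power_series_sum_approx e eta :
  (forall i, 0 <= e i) -> abs_bounded c e -> 0 < eta ->
  exists A0, forall A z, (A0 `<=` A)%fset -> (forall i, normc (z ord0 i) <= e i) ->
    normc (power_series_sum c z - \sum_(J <- A) power_term c z J) <= eta.
Proof.
move=> e0 be; pose S z A := \sum_(J <- A) power_term c z J.
have cauchy eps : 0 < eps -> exists A0, forall z A A',
    (forall i, normc (z ord0 i) <= e i) -> (A0 `<=` A)%fset -> (A `<=` A')%fset ->
    normc (S z A' - S z A) <= eps.
  move=> eps0; have [A0 hA0] := abs_bounded_tail e0 be eps0.
  exists A0 => z A A' ze A0A AA'; rewrite /S (sum_fsetD _ AA') addrAC subrr add0r.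
  rewrite (le_trans (normc_sum _ _ _)) //; apply: le_trans (hA0 A' (fsubset_trans A0A
    AA')).
  apply: (@le_trans _ _ (\sum_(J <- (A' `\` A)%fset) abs_term c e J)).
    by apply: ler_sum => J _; rewrite normc_power_term abs_term_le // => i;
      rewrite normc_ge0 ze.
  apply: ler_sum_fset => [J|]; first exact: abs_term_ge0.
  exact: fsetDS.
have limit z : (forall i, normc (z ord0 i) <= e i) -> exists l : C R, forall A eps,
    (forall A', (A `<=` A')%fset -> normc (S z A' - S z A) <= eps) ->
    normc (l - S z A) <= eps + eps.
  move=> ze; have cvgRe eps : 0 < eps -> exists A0, forall A, (A0 `<=` A)%fset ->
      normc (S z A - S z A0) <= eps.
    by move=> /cauchy[A0 hA0]; exists A0 => A; exact: hA0 (fsubset_refl _).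
  have [l1 hl1] : exists l, forall A0 eps,
      (forall A, (A0 `<=` A)%fset -> `|complex.Re (S z A) - complex.Re (S z A0)| <=
        eps) ->
      `|l - complex.Re (S z A0)| <= eps.
    apply: real_net_limit => eps /cvgRe[A0 hA0]; exists A0 => A /hA0.
    by apply: le_trans; rewrite -raddfB normc_Re.
  have [l2 hl2] : exists l, forall A0 eps,
      (forall A, (A0 `<=` A)%fset -> `|complex.Im (S z A) - complex.Im (S z A0)| <=
        eps) ->
      `|l - complex.Im (S z A0)| <= eps.
    apply: real_net_limit => eps /cvgRe[A0 hA0]; exists A0 => A /hA0.
    by apply: le_trans; rewrite -raddfB normc_Im.
  exists (Complex l1 l2) => A eps hA; apply: (le_trans (normc_le_ReIm _)).
  rewrite !raddfB /= lerD //; [apply: hl1|apply: hl2] => A' /hA; apply: le_trans;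
    by rewrite -raddfB ?normc_Re ?normc_Im.
have sumE z l : (forall i, normc (z ord0 i) <= e i) ->
    (forall A eps, (forall A', (A `<=` A')%fset -> normc (S z A' - S z A) <= eps) ->
      normc (l - S z A) <= eps + eps) -> power_series_sum c z = l.
  move=> ze hl; apply: (@cvg_lim _ (@norm_hausdorff _ (C R)) _ _
    summability.totally_filter).
  move=> U /nbhs_normc[d d0 hd].
  have d4 : 0 < d / 4 by rewrite divr_gt0.
  have [A0 hA0] := cauchy _ d4; exists A0 => // A /= A0A; apply: hd.
  rewrite /summability.partial_sum -(big_seq_fsetE _ _ xpredT (power_term c z))
    normc_distC.
  have := hl A (d / 4) (fun A' => hA0 z A A' ze A0A); lra.
move=> eta0; have eta2 : 0 < eta / 2 by rewrite divr_gt0.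
have [A0 hA0] := cauchy _ eta2; exists A0 => A z A0A ze.
have [l hl] := limit z ze; rewrite (sumE z l ze hl) [eta]splitr.
by apply: hl => A'; apply: hA0.
Qed.

End power_series_approximation.

Section extension.
Variables (R : realType) (N : nat) (c : {ffun 'I_N -> nat} -> C R).
Implicit Types (A : {fset {ffun 'I_N -> nat}}) (z q p : 'rV[C R]_N) (e s : 'I_N -> R).
Implicit Types (w : 'I_N -> C R) (g : 'rV[C R]_N -> C R).

Lemma abs_bounded_of_coef_bound e rho (M : R) : (forall i, 0 <= e i < rho i) ->
  (forall J, abs_term c rho J <= M) -> abs_bounded c e.
Proof.
move=> erho hM; have rho0 i : 0 < rho i by have := erho i; lra.
pose t i := e i / rho i.
have t01 i : 0 <= t i < 1.
  by have /andP[e0 er] := erho i; rewrite divr_ge0 ?(ltW (rho0 i)) // ltr_pdivrMr //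
    mul1r.
exists (M * \prod_i (1 - t i)^-1) => A.
have M0 : 0 <= M by apply: le_trans (hM [ffun=> 0%N]); apply: abs_term_ge0 => i;
  exact: ltW.
apply: le_trans (ler_wpM2l M0 (sum_prod_geometric_le A t01)).
rewrite mulr_sumr; apply: ler_sum => J _.
have -> : abs_term c e J = abs_term c rho J * \prod_i t i ^+ J i.
  rewrite /abs_term -mulrA -big_split /=; congr (_ * _); apply: eq_bigr => i _.
  by rewrite -exprMn /t mulrC divfK // gt_eqF.
by rewrite ler_wpM2r // prodr_ge0 // => i _; rewrite exprn_ge0 //; case/andP: (t01 i).
Qed.

Lemma posfun_lower_bound (a : 'I_N -> R) : (forall i, 0 < a i) ->
  exists2 x, 0 < x < 1 & forall i, x < a i.
Proof.
move=> a0; exists (\big[Num.min/1]_i a i / 2).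
  have : 0 < \big[Num.min/1]_i a i by apply: lt_bigmin => // i _; exact: a0.
  have : \big[Num.min/1]_i a i <= 1 by exact: bigmin_le_id.
  by lra.
move=> i; have : \big[Num.min/1]_i a i <= a i by exact: bigmin_le.
by have := a0 i; lra.
Qed.

Definition ray w s (kappa : R) (l : C R) : 'rV[C R]_N :=
  \row_i (w i * ((s i)%:C%C + l * kappa%:C%C)).

Lemma derivable_ray g w s kappa l :
  differentiable g (ray w s kappa l) -> derivable (g \o ray w s kappa) l 1.
Proof.
move=> dg; have := @diff_derivable _ _ _ g _ (\row_i (w i * kappa%:C%C)) dg.
rewrite /derivable (_ : (fun t => _) = (fun t : C R => t^-1 *: ((g \o ray w s kappa \o
  shift l) (t *: 1) - (g \o ray w s kappa) l))) //.
apply/funext => t /=; congr (_ *: (g _ - _)).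
by apply/rowP => i; rewrite !mxE [t *: 1]mulr1; ring.
Qed.

Definition ray_poly s (kappa : R) (J : {ffun 'I_N -> nat}) : {poly C R} :=
  \prod_i ((s i)%:C%C%:P + kappa%:C%C *: 'X) ^+ J i.

Lemma power_term_ray w s kappa l J : power_term c (ray w s kappa l) J =
  c J * \prod_i w i ^+ J i * (ray_poly s kappa J).[l].
Proof.
rewrite /power_term /ray_poly horner_prod -mulrA -big_split /=; congr (_ * _).
by apply: eq_bigr => i _; rewrite mxE exprMn !hornerE (mulrC l).
Qed.

Lemma extension_coef_le s e (kappa M : R) J m :
  0 < kappa -> (forall i, 0 <= s i < e i) -> abs_bounded c e ->
  (forall w, (forall i, normc (w i) = 1) -> exists g,
    [/\ forall l, normc l < 2 -> differentiable g (ray w s kappa l),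
      forall l, normc l < 2 -> normc (g (ray w s kappa l)) <= M &
      forall l, normc l < 2 -> domain_of_convergence c (ray w s kappa l) ->
        g (ray w s kappa l) = power_series_sum c (ray w s kappa l)]) ->
  normc (c J * (ray_poly s kappa J)`_m) <= M.
Proof.
move=> kappa0 se be hg; apply/ler_addgt0Pr => eta eta0.
have e0 i : 0 <= e i by have := se i; lra.
have [eps /andP[eps0 eps1] heps] : exists2 eps, 0 < eps < 1 & forall i,
  eps < (e i - s i) / kappa.
  by apply: posfun_lower_bound => i; rewrite divr_gt0 // subr_gt0; case/andP: (se i).
have epsm : 0 < eps ^+ m by rewrite exprn_gt0.
have [A0 hA0] := power_series_sum_approx e0 be (mulr_gt0 eta0 epsm).
pose A := (J |` A0)%fset; have A0A : (A0 `<=` A)%fset by exact: fsubsetUr.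
apply: (@torus_coef_le _ _ (fun J => c J * (ray_poly s kappa J)`_m) A).
  by rewrite !inE eqxx.
move=> w hw; have [g [dg gM gf]] := hg w hw.
pose P : {poly C R} := \sum_(J <- A) (c J * \prod_i w i ^+ J i) *: ray_poly s kappa J.
have -> : \sum_(J <- A) c J * (ray_poly s kappa J)`_m * \prod_i w i ^+ J i = P`_m.
  by rewrite coef_sum; apply: eq_bigr => K _; rewrite coefZ mulrAC.
have -> : M + eta = M + eta * eps ^+ m / eps ^+ m by rewrite mulfK // gt_eqF.
apply: (@cauchy_coef_le _ (g \o ray w s kappa)) => [l /dg| l /gM| |l leps] //.
- exact: derivable_ray.
- by rewrite eps0.
have l2 : normc l < 2 by rewrite leps; lra.
have ze i : normc (ray w s kappa l ord0 i) < e i.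
  rewrite mxE normc_mul hw mul1r (le_lt_trans (normc_add _ _)) // normc_mul leps.
  rewrite !normc_real ger0_norm; last by case/andP: (se i).
  by rewrite gtr0_norm // -ltrBrDl -ltr_pdivlMr.
rewrite /= gf //; last by apply/domain_of_convergenceP; exists e.
have -> : P.[l] = \sum_(J <- A) power_term c (ray w s kappa l) J.
  by rewrite horner_sum; apply: eq_bigr => K _; rewrite hornerZ power_term_ray.
by apply: hA0 => // i; exact: ltW.
Qed.

Lemma abs_term_le_of_coef_le s (kappa M : R) J : 0 < kappa -> (forall i, 0 <= s i) ->
  (forall m, normc (c J * (ray_poly s kappa J)`_m) <= M) ->
  abs_term c (fun i => s i + kappa / 2) J <= 2 * M.
Proof.
move=> kappa0 s0 hM.
have M0 : 0 <= M by apply: le_trans (hM 0%N); exact: normc_ge0.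
pose x : C R := (2^-1)%:C%C.
have nx : normc x = 2^-1 by rewrite normc_real gtr0_norm.
have -> : abs_term c (fun i => s i + kappa / 2) J = normc (c J * (ray_poly s kappa
  J).[x]).
  rewrite normc_mul horner_prod normc_prod; congr (_ * _); apply: eq_bigr => i _.
  rewrite !hornerE normc_exp /x -rmorphM -rmorphD normc_real ger0_norm //=.
  by rewrite addr_ge0 // mulr_ge0 // ltW.
rewrite horner_coef mulr_sumr (le_trans (normc_sum _ _ _)) //.
apply: (@le_trans _ _ (\sum_(m < size (ray_poly s kappa J)) 2^-1 ^+ m * M)).
  by apply: ler_sum => m _; rewrite mulrA normc_mul normc_exp nx mulrC ler_wpM2l
    ?exprn_ge0.
have half : 0 <= (2^-1 : R) < 1 by apply/andP; split; lra.
rewrite -mulr_suml ler_wpM2r // (le_trans (sum_geometric_le _ half)) //.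
by rewrite (_ : 1 - 2^-1 = 2^-1) ?invrK //; lra.
Qed.

End extension.

Section boundary_torus.
Variables (R : realType) (N : nat) (c : {ffun 'I_N -> nat} -> C R).
Implicit Types (z q p : 'rV[C R]_N) (g : 'rV[C R]_N -> C R).
Local Notation D := (domain_of_convergence c).

Definition bounded_extension q n : Prop := exists g,
  [/\ forall z, polydisc q (fun=> n.+1%:R^-1) z -> differentiable g z,
    forall z, polydisc q (fun=> n.+1%:R^-1) z -> normc (g z) <= n%:R &
    forall z, polydisc q (fun=> n.+1%:R^-1) z -> D z -> g z = power_series_sum c z].

Lemma same_modulus_normc p q : absolute_map q = absolute_map p ->
  forall i, normc (q ord0 i) = normc (p ord0 i).
Proof. by move=> /rowP h i; have := h i; rewrite !mxE. Qed.

Lemma bounded_extension_domain p n : closure D p ->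
  (forall q, absolute_map q = absolute_map p -> bounded_extension q n) -> D p.
Proof.
move=> clp ext; pose delta : R := n.+1%:R^-1.
have delta0 : 0 < delta by rewrite invr_gt0.
pose kappa := delta / 4; have kappa0 : 0 < kappa by rewrite divr_gt0.
pose s i := Num.max 0 (normc (p ord0 i) - kappa / 4).
have s0 i : 0 <= s i by rewrite le_max lexx.
have sp i : normc (p ord0 i) - kappa / 4 <= s i by rewrite le_max lexx orbT.
have ps i : s i <= normc (p ord0 i).
  by rewrite ge_max normc_ge0 /=; lra.
have [z [/domain_of_convergenceP[e ze be] zp]] : D `&` [set z | forall i,
  normc (z ord0 i - p ord0 i) < kappa / 4] !=set0.
  by apply: clp; apply/nbhs_row_normc; exists (kappa / 4); rewrite ?divr_gt0.
have se i : 0 <= s i < e i.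
  rewrite s0 /= (le_lt_trans _ (ze i)) // ge_max normc_ge0 /=.
  by have := zp i; have := normc_dist (p ord0 i) (z ord0 i); rewrite normc_distC; lra.
have coef J m : normc (c J * (ray_poly s kappa J)`_m) <= n%:R.
  apply: extension_coef_le be _ => // w hw.
  pose q : 'rV[C R]_N := \row_i (w i * (normc (p ord0 i))%:C%C).
  have [|g [dg gM gf]] := ext q.
    by apply/rowP => i; rewrite !mxE normc_mul hw mul1r normc_real ger0_norm // normc_ge0.
  have inq l : normc l < 2 -> polydisc q (fun=> delta) (ray w s kappa l).
    move=> l2 i; rewrite !mxE -mulrBr normc_mul hw mul1r.
    have -> : (s i)%:C%C + l * kappa%:C%C - (normc (p ord0 i))%:C%C =
      (s i - normc (p ord0 i))%:C%C + l * kappa%:C%C by rewrite rmorphB /=; ring.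
    rewrite (le_lt_trans (normc_add _ _)) // normc_mul !normc_real (gtr0_norm kappa0).
    rewrite ler0_norm; last by rewrite subr_le0.
    have := sp i; have : normc l * kappa < 2 * kappa by rewrite ltr_pM2r.
    by rewrite /kappa in kappa0 *; lra.
  by exists g; split=> l /inq; [exact: dg|exact: gM|exact: gf].
apply/domain_of_convergenceP; exists (fun i => normc (p ord0 i) + kappa / 8) => [i|].
  by rewrite ltrDl divr_gt0.
apply: (@abs_bounded_of_coef_bound _ _ _ _ (fun i => s i + kappa / 2) (2 * n%:R)) =>
  [i|J].
  by rewrite addr_ge0 ?normc_ge0 ?divr_ge0 ?(ltW kappa0) //=; have := sp i; lra.
exact: abs_term_le_of_coef_le.
Qed.

Lemma regular_bounded_extension q : regular_point D (power_series_sum c) q ->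
  exists2 d : R, 0 < d & exists n0, forall n q', (n0 <= n)%N ->
    (forall i, normc (q' ord0 i - q ord0 i) < d) -> bounded_extension q' n.
Proof.
move=> [_ [r r0 [g dg gf]]].
have [rho /andP[rho0 _] rhor] := posfun_lower_bound r0.
have qq : polydisc q r q by move=> i; rewrite subrr normc_zero.
have cg : {for q, continuous g} by apply: differentiable_continuous; exact: dg.
have : nbhs q [set z | normc (g z - g q) < 1].
  by apply: (cg [set y | normc (y - g q) < 1]); apply/nbhs_normc; exists 1.
move=> /nbhs_row_normc[d1 d10 hd1].
pose d := Num.min rho d1 / 2.
have dm : d + d <= Num.min rho d1 by rewrite /d -splitr.
have d0 : 0 < d by rewrite divr_gt0 // lt_min rho0.
have [drho dd1] : d + d <= rho /\ d + d <= d1.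
  by apply/andP; rewrite -le_min.
exists d => //; exists (maxn (Num.truncn d^-1) (Num.truncn (normc (g q) + 1)).+1) => n q'.
rewrite geq_max => /andP[nd nM] hq'.
have dn : n.+1%:R^-1 <= d.
  rewrite invf_ple ?posrE // (le_trans (ltW (truncnS_gt _))) //.
  by rewrite ler_nat ltnS.
have Mn : normc (g q) + 1 <= n%:R.
  by rewrite (le_trans (ltW (truncnS_gt _))) // ler_nat.
have near z i : polydisc q' (fun=> n.+1%:R^-1) z -> normc (z ord0 i - q ord0 i) < d + d.
  move=> /(_ i) hz; rewrite -(subrKA (q' ord0 i)) (le_lt_trans (normc_add _ _)) //.
  by rewrite ltrD // (lt_le_trans hz).
have inr z : polydisc q' (fun=> n.+1%:R^-1) z -> polydisc q r z.
  by move=> hz i; have := near z i hz; have := rhor i; lra.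
exists g; split=> z hz; [exact: dg (inr z hz)| |exact: gf (inr z hz)].
have : normc (g z - g q) < 1 by apply: hd1 => i; have := near z i hz; lra.
by have := normc_dist (g z) (g q); lra.
Qed.

Lemma cis_near1 : exists2 d : R, 0 < d & forall t,
  `|t| < d -> normc (cis t - 1) <= 2 * `|t|.
Proof.
have [d d0 hd] := cexp_approx (@ltr01 R); exists d => // t td.
have := hd 0 t; rewrite normr0 d0 => /(_ isT td);
  rewrite add0r mul1r /cexp expR0 mul1r => h.
rewrite -(subrK (Complex 0 t) (cis t - 1)) (le_trans (normc_add _ _)) //.
rewrite mulr_natl mulr2n lerD // (le_trans (normc_le_ReIm _)) //=.
by rewrite normr0 add0r.
Qed.

Lemma torus_bounded_extension p :
  (forall q, absolute_map q = absolute_map p -> regular_point D (power_series_sum c) q) ->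
  exists n, forall q, absolute_map q = absolute_map p -> bounded_extension q n.
Proof.
move=> reg; pose tor (t : 'rV[R]_N) : 'rV[C R]_N :=
  \row_i ((normc (p ord0 i))%:C%C * cis (t ord0 i)).
have torE t : absolute_map (tor t) = absolute_map p.
  by apply/rowP => i; rewrite !mxE normc_scaled_polar // normc_ge0.
pose K := [set t : 'rV[R]_N | forall i, `[0, 2 * pi]%classic (t ord0 i)].
have Kc : compact K by apply: (@rV_compact R N (fun=> `[0, 2 * pi]%classic)) => i;
  exact: segment_compact.
have /compact_near_coveringP/(_ nat \oo%classic (fun n t => bounded_extension (tor t)
  n)) := Kc.
move=> /(_ _ _)[t _|n0 _ hn0].
  have [d d0 [n0 hn0]] := regular_bounded_extension (reg _ (torE t)).
  have [d1 d10 hd1] := cis_near1.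
  pose m i := normc (p ord0 i).
  have [b /andP[b0 _] bd] : exists2 b, 0 < b < 1 & forall i,
    b < Num.min d1 (d / (2 * (m i + 1))).
    apply: posfun_lower_bound => i; rewrite lt_min d10 divr_gt0 // mulr_gt0 //
      ltr_wpDl //.
    exact: normc_ge0.
  exists ([set t' : 'rV[R]_N | forall i, `|t' ord0 i - t ord0 i| < b],
    [set n | (n0 <= n)%N]).
    split; last by exists n0.
    apply/nbhs_ballP; exists b => // t' [_ ht'] i; rewrite distrC; exact: ht'.
  move=> [t' n] /= [tt' n0n]; apply: hn0 n0n _ => i; rewrite !mxE.
  have := bd i; rewrite lt_min => /andP[bd1 bdd]; have t'b := tt' i.
  have m0 : 0 <= m i := normc_ge0 _.
  have -> : (m i)%:C%C * cis (t' ord0 i) - (m i)%:C%C * cis (t ord0 i) =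
      (m i)%:C%C * cis (t ord0 i) * (cis (t' ord0 i - t ord0 i) - 1).
    by rewrite mulrBr mulr1 -mulrA -cisD (addrC (t ord0 i)) subrK.
  rewrite normc_mul normc_scaled_polar //.
  have := hd1 _ (lt_trans t'b bd1).
  move: bdd; rewrite ltr_pdivlMr; last by lra.
  nra.
exists n0 => q qp; have qm := same_modulus_normc qp.
pose t : 'rV[R]_N := \row_i sval (cid2 (cis_polar (q ord0 i))).
have -> : q = tor t.
  apply/rowP => i; rewrite !mxE -qm; by case: cid2.
apply: (hn0 n0) => //= i; rewrite mxE; case: cid2 => x /= x02 _.
by rewrite in_itv.
Qed.

Lemma boundary_same_modulus p q : absolute_map q = absolute_map p ->
  boundary D p -> boundary D q.
Proof.
move=> /same_modulus_normc qp [clp nDp].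
have intD : interior D = D by apply/interior_id; exact: open_interior.
rewrite intD in nDp.
split; last first.
  rewrite intD => /domain_of_convergenceP[e qe be]; apply: nDp.
  by apply/domain_of_convergenceP; exists e => // i; rewrite -qp.
move=> U /nbhs_row_normc[d d0 hU].
have [w w1 wE] : exists2 w : 'I_N -> C R, (forall i, normc (w i) = 1) &
    forall i, q ord0 i = w i * p ord0 i.
  have rot i : exists u : C R, normc u = 1 /\ q ord0 i = u * p ord0 i.
    have [a _ pa] := cis_polar (p ord0 i); have [b _ qb] := cis_polar (q ord0 i).
    exists (cis (b - a)); split; first exact: normc_cis.
    by rewrite qb [in RHS]pa qp mulrCA -cisD subrK.
  by have [w hw] := choice rot; exists w => i; case: (hw i).
have [z [Dz zp]] : D `&` [set z | forall i, normc (z ord0 i - p ord0 i) < d] !=set0.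
  by apply: clp; apply/nbhs_row_normc; exists d.
exists (\row_i (w i * z ord0 i)); split.
  move/domain_of_convergenceP: Dz => [e ze be]; apply/domain_of_convergenceP;
    exists e => // i.
  by rewrite mxE normc_mul w1 mul1r.
by apply: hU => i; rewrite mxE wE -mulrBr normc_mul w1 mul1r.
Qed.

End boundary_torus.

Theorem proposition3p13 (R : realType) (N : nat)
    (c : {ffun 'I_N -> nat} -> C R)
    (D_neq0 : domain_of_convergence c <> set0)
    (D_neqT : domain_of_convergence c <> setT) :
  absolute_map (R := R) (N := N) @`
      singular_points (domain_of_convergence c) (power_series_sum c) =
  absolute_map (R := R) (N := N) @` boundary (domain_of_convergence c).
Proof.
apply/seteqP; split=> [_ [q [bq _] <-]|_ [p bp <-]]; first by exists q.
apply: contrapT => nosing.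
have [n hn] : exists n, forall q, absolute_map q = absolute_map p -> bounded_extension
  c q n.
  apply: torus_bounded_extension => q qp; apply: contrapT => nreg; apply: nosing.
  exists q; last exact: qp.
  by split; [exact: (boundary_same_modulus qp bp) | exact: nreg].
have [clp nDp] := bp; apply: nDp; apply: nbhs_interior.
exact: bounded_extension_domain hn.
Qed.
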